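(* $\operatorname{achr}(K_6\square K_8)=21$.
   Context: For a finite simple graph $G$, $\operatorname{achr}(G)$ (the achromatic number) is the maximum number of colours in a proper vertex colouring of $G$ that is complete, i.e. every pair of distinct colours appears on the two ends of some edge. $K_6\square K_8$ is the Cartesian product of the complete graphs $K_6$ and $K_8$ (vertex set $[1,6]\times[1,8]$, two vertices adjacent iff they agree in exactly one coordinate). *)

(* Defs.v *)
From mathcomp Require Import all_boot.
Set Implicit Arguments.
Unset Strict Implicit.
Unset Printing Implicit Defensive.

Record sgraph := SGraph {
  vertex : finType;
  adj : rel vertex;
  adj_sym : symmetric adj;
  adj_irrefl : irreflexive adj
}.

Section Achromatic.

Variable G : sgraph.

Definition proper_colouring k (f : {ffun vertex G -> 'I_k}) : bool :=
  [forall x, forall y, adj x y ==> (f x != f y)].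

Definition complete_colouring k (f : {ffun vertex G -> 'I_k}) : bool :=
  [forall i, forall j, (i != j) ==>
     [exists x, exists y, [&& adj x y, f x == i & f y == j]]].

(* Surjectivity says that exactly k colours are used; it follows from
   completeness when k > 1, but not when k = 1. *)
Definition uses_all_colours k (f : {ffun vertex G -> 'I_k}) : bool :=
  [forall i, exists x, f x == i].

Definition has_complete_colouring (k : nat) : bool :=
  [exists f : {ffun vertex G -> 'I_k},
     [&& proper_colouring f, complete_colouring f & uses_all_colours f]].

(* The range k <= #|vertex G| loses nothing: see [has_complete_colouring_leq]. *)
Definition achr : nat :=
  \max_(k < #|vertex G|.+1 | has_complete_colouring k) k.

Lemma has_complete_colouring_leq k :
  has_complete_colouring k -> k <= #|vertex G|.
Proof.
case/existsP=> f /and3P[_ _ /forallP fS].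
rewrite -[k in k <= _]card_ord; apply: leq_trans (leq_image_card f predT).
apply/subset_leq_card/subsetP => i _.
by have /existsP[x /eqP <-] := fS i; apply: image_f.
Qed.

End Achromatic.

Lemma neq_sym (T : eqType) : symmetric (fun x y : T => x != y).
Proof. by move=> x y; rewrite eq_sym. Qed.

Lemma neq_irrefl (T : eqType) : irreflexive (fun x y : T => x != y).
Proof. by move=> x; rewrite eqxx. Qed.

Definition complete_graph (n : nat) : sgraph :=
  SGraph (@neq_sym 'I_n) (@neq_irrefl 'I_n).

Section CartesianProduct.

Variables G H : sgraph.

Definition cart_adj : rel (vertex G * vertex H) :=
  fun u v => ((u.1 == v.1) && adj u.2 v.2) || (adj u.1 v.1 && (u.2 == v.2)).

Lemma cart_adj_sym : symmetric cart_adj.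
Proof.
move=> u v; rewrite /cart_adj (eq_sym u.1) (eq_sym u.2).
by rewrite (@adj_sym G u.1) (@adj_sym H u.2).
Qed.

Lemma cart_adj_irrefl : irreflexive cart_adj.
Proof. by move=> u; rewrite /cart_adj !adj_irrefl andbF. Qed.

Definition cartesian_product : sgraph := SGraph cart_adj_sym cart_adj_irrefl.

End CartesianProduct.

Lemma adj_cartesian_complete m n
    (u v : vertex (cartesian_product (complete_graph m) (complete_graph n))) :
  adj u v = (u.1 == v.1) (+) (u.2 == v.2).
Proof.
case: u v => [a b] [c d]; rewrite /adj /= /cart_adj /=.
by case: (a == c); case: (b == d).
Qed.

(* Main.v *)
Require Import Defs.
From mathcomp Require Import all_boot fingroup perm.
From mathcomp Require Import zify.
Set Implicit Arguments.
Unset Strict Implicit.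
Unset Printing Implicit Defensive.

(** An explicit grid gives a complete 21-colouring. Conversely, in a complete
    colouring with k >= 22 colours each colour occurs at least twice, so, there
    being 48 cells, at least 3k - 48 >= 18 colours occur exactly twice; fix 18 of
    them, each a couple of cells in distinct rows and columns. The two rows and
    two columns through such a couple (its cross) contain 22 further cells, and
    these must show all k - 1 >= 21 other colours. Hence k <= 23, every other
    couple meets the cross, at most one other couple lies inside it, and at most
    22 - 17 = 5 of its cells are free, i.e. belong to none of the 18 couples.
    There are 48 - 36 = 12 free cells, and the free cells of a column have
    distinct colours, so a column has at most k - 18 <= 5 of them. Some column
    meets at least five of the couples; up to permuting rows and columns there
    are few ways to place these five, and an exhaustive search, evaluated by the
    kernel, shows that none of them extends to 18 couples. *)

(** * The search *)

Definition cell : Type := (nat * nat)%type.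
Definition couple : Type := (cell * cell)%type.

Definition cells : seq cell := [seq (r, c) | r <- iota 0 6, c <- iota 0 8].

Definition couples : seq couple :=
  [seq p <- [seq (x, y) | x <- cells, y <- cells] |
     (p.1.1 < p.2.1) && (p.1.2 != p.2.2)].

(* [eqn] rather than [==] keeps the kernel's evaluation of the search cheap. *)
Definition eqc (x y : cell) : bool := eqn x.1 y.1 && eqn x.2 y.2.

Definition covers (p : couple) (z : cell) : bool := eqc z p.1 || eqc z p.2.

Definition cross (p : couple) (z : cell) : bool :=
  [|| eqn z.1 p.1.1, eqn z.1 p.2.1, eqn z.2 p.1.2 | eqn z.2 p.2.2].

Definition meets (p q : couple) : bool := cross p q.1 || cross p q.2.
Definition inside (p q : couple) : bool := cross p q.1 && cross p q.2.

(* The mark of a couple p is true when some chosen couple other than p is known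
   to lie inside the cross of p; then no second one may. *)
Definition marked : Type := seq (couple * bool).

(** [extend] passes as [full] the couples whose cross has just received its one permitted couple:
    [a] itself if it was marked, and the chosen couples around [a]. Candidates inside crosses filled
    earlier were discarded at that time. *)
Definition keep (a : couple) (full : seq couple) (b : couple * bool) : bool :=
  [&& ~~ covers a b.1.1, ~~ covers a b.1.2, meets b.1 a,
      ~~ has (inside^~ b.1) full & ~~ (b.2 && inside b.1 a)].

Definition mark (a : couple) (b : couple * bool) : couple * bool :=
  (b.1, b.2 || inside b.1 a).

Definition extend (ch cs : marked) (a : couple * bool) : option (marked * marked) :=
  let hit := [seq c <- ch | inside c.1 a.1] in
  if has snd hit then None else
  let full := unzip1 (if a.2 then a :: hit else hit) in
  Some (a :: map (mark a.1) ch, map (mark a.1) [seq b <- cs | keep a.1 full b]).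

Fixpoint incr_cell (g : seq (seq nat)) (r c : nat) : seq (seq nat) :=
  if g is s :: g' then
    if r is r'.+1 then s :: incr_cell g' r' c else incr_nth s c :: g'
  else [::].

(** Entry (r, c) counts the candidates covering that cell. Rows grow on demand, so a missing entry
    means zero. *)
Definition tally (cs : marked) : seq (seq nat) :=
  foldr (fun b g => incr_cell (incr_cell g b.1.1.1 b.1.1.2) b.1.2.1 b.1.2.2)
    (nseq 6 [::]) cs.

(* Only a branching heuristic: a cell of [open] covered by fewest candidates. *)
Definition best_cell (open : seq cell) (cs : marked) : cell :=
  let g := tally cs in
  (foldr (fun z b => let n := nth 0 (nth [::] g z.1) z.2 in
     if n < b.2 then (z, n) else b) ((0, 0), 100) open).1.

(** The head of [xs] is the cell freed last, so only its column can have just become too full. *)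
Definition overfull (ch : marked) (xs : seq cell) : bool :=
  [|| 12 < size xs,
      5 < count (fun y => eqn y.2 (head (0,0) xs).2) xs
    | has (fun c => 5 < count (cross c.1) xs) ch].

(* [ch]: chosen couples; [cs]: candidates; [xs]: free cells; [open]: undecided
   cells. Each branching cell is either free or covered by a candidate. The value
   [true] means refuted; running out of fuel or of open cells gives [false]. *)
Fixpoint refute (fuel : nat) (open : seq cell) (ch cs : marked) (xs : seq cell) :
    bool :=
  if fuel is n.+1 then
    if overfull ch xs then true else
    let z := best_cell open cs in
    if z \in open then
      if refute n [seq y <- open | ~~ eqc z y] ch [seq b <- cs | ~~ covers b.1 z]
           (z :: xs) then
        all (fun b => if covers b.1 z then
               if extend ch cs b is Some (ch', cs') then
                 refute n [seq y <- open | ~~ covers b.1 y] ch' cs' xs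
               else true
             else true) cs
      else false
    else false
  else false.

Definition mate (p : couple) (z : cell) : cell := if eqc z p.1 then p.2 else p.1.

(* Places the couples through (i, 0) for i < 5. The rows in [rr, 5) and the
   columns from cc on are untouched so far, hence interchangeable: a mate in a
   new row or column may be assumed to use the first such one. *)
Fixpoint refute_column (n i rr cc : nat) (ch cs : marked) : bool :=
  if n is m.+1 then
    let rr' := maxn rr i.+1 in
    all (fun b => let w := mate b.1 (i, 0) in
      if [&& covers b.1 (i, 0), (w.1 <= rr') || (w.1 == 5) & w.2 <= cc] then
        if extend ch cs b is Some (ch', cs') then
          refute_column m i.+1 (if w.1 == 5 then rr' else maxn rr' w.1.+1)
            (maxn cc w.2.+1) ch' cs'
        else true
      else true) cs
  else refute 48 [seq z <- cells | ~~ has (fun c => covers c.1 z) ch] ch cs [::].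

(** Column 0 counts as touched from the start, whence the 1. Row 5 is never interchanged with
    another, since its cell in column 0 may be free. *)
Lemma column_refuted :
  refute_column 5 0 0 1 [::] [seq (p, false) | p <- couples].
Proof. by vm_compute. Qed.

Lemma eqcE x y : eqc x y = (x == y).
Proof. by case: x y => [a b] [c d]; rewrite /eqc !eqnE. Qed.

Lemma coversE p z : covers p z = (z == p.1) || (z == p.2).
Proof. by rewrite /covers !eqcE. Qed.

Lemma mem_cells z : (z \in cells) = (z.1 < 6) && (z.2 < 8).
Proof.
case: z => r c; apply/allpairsP/andP => [[[i j]] []|[ri cj]].
  by rewrite !mem_iota => ? ? [-> ->].
by exists (r, c); rewrite !mem_iota.
Qed.

Lemma mem_couples p : (p \in couples) =
  [&& p.1 \in cells, p.2 \in cells, p.1.1 < p.2.1 & p.1.2 != p.2.2].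
Proof.
rewrite mem_filter andbC [RHS]andbA; congr (_ && _).
case: p => x y; apply/allpairsP/andP => [[[i j]] /= [xi yi [-> ->]] | [xi yi]] //.
by exists (x, y).
Qed.

(** * Soundness of the search *)

(** All that the search knows about a colouring: [P] stands for the 18 couples and [free] for the
    cells outside them. *)
Record configuration (P : pred couple) (free : pred cell) : Prop :=
  Configuration {
    conf_disjoint : forall p q z, P p -> P q -> covers p z -> covers q z -> p = q;
    conf_meets : forall p q, P p -> P q -> meets p q;
    conf_inside : forall p q r, P p -> P q -> P r -> uniq [:: p; q; r] ->
      inside p q -> inside p r -> False;
    conf_cross : forall p xs, P p -> uniq xs -> all free xs ->
      count (cross p) xs <= 5;
    conf_size : forall xs, uniq xs -> all free xs -> size xs <= 12;
    conf_column : forall c xs, uniq xs -> all free xs ->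
      count (fun y => eqn y.2 c) xs <= 5;
    conf_cell : forall z, z \in cells -> free z \/ exists2 p, P p & covers p z;
    conf_free : forall p z, P p -> free z -> ~~ covers p z
  }.

(** Only a true mark needs a witness; a false one merely makes the search prune less. *)
Definition mark_ok (s : seq couple) (b : couple * bool) : bool :=
  b.2 ==> has (fun q => (q != b.1) && inside b.1 q) s.

Definition complete_for (P : pred couple) (ch cs : marked) : Prop :=
  forall p, P p -> p \notin unzip1 ch ->
  exists2 b, b \in cs & (b.1 == p) && mark_ok (unzip1 ch) b.

Lemma unzip1_mark a s : unzip1 (map (mark a) s) = unzip1 s.
Proof. by rewrite /unzip1 -map_comp. Qed.

Lemma mark_ok_cons q s b : mark_ok s b -> mark_ok (q :: s) b.
Proof. by rewrite /mark_ok; case: b.2 => //= ->; rewrite orbT. Qed.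

Lemma mark_ok_mark a s b : b.1 != a -> mark_ok s b -> mark_ok (a :: s) (mark a b).
Proof.
rewrite /mark_ok /= (eq_sym b.1) => ->; case: (inside _ a); rewrite ?orbT //.
by rewrite orbF.
Qed.

Section Soundness.

Variables (P : pred couple) (free : pred cell).
Hypothesis conf : configuration P free.

Lemma mark_ok_conflict s b q : all P s -> mark_ok s b -> b.2 -> P b.1 -> P q ->
  q != b.1 -> q \notin s -> inside b.1 q -> False.
Proof.
move=> sP + b2; rewrite /mark_ok b2 /= => /hasP[r rs /andP[rb br]] Pb Pq qb qs bq.
apply: (conf_inside conf Pb Pq (allP sP _ rs) _ bq br).
have qr : q != r by apply: contraNneq qs => ->.
by rewrite /= !inE negb_or qr (eq_sym _ q) qb (eq_sym _ r) rb.
Qed.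

(** Choosing a couple of [P] loses no other couple of [P], because each rejection test in [keep] and
    [extend] would contradict a clause of [configuration]. *)
Lemma extend_sound ch cs a :
  all P (unzip1 ch) -> all (mark_ok (unzip1 ch)) ch -> complete_for P ch cs ->
  P a.1 -> a.1 \notin unzip1 ch -> mark_ok (unzip1 ch) a ->
  exists ch' cs', [/\ extend ch cs a = Some (ch', cs'),
    unzip1 ch' = a.1 :: unzip1 ch, all (mark_ok (unzip1 ch')) ch'
    & complete_for P ch' cs'].
Proof.
move=> chP chm compl aP ach am; rewrite /extend; case: ifPn => [/hasP[c]|].
  rewrite mem_filter => /andP[ca cch] c2.
  have cch1 : c.1 \in unzip1 ch by apply: map_f.
  case: (mark_ok_conflict chP (allP chm _ cch) c2 (allP chP _ cch1) aP _ ach ca).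
  by apply: contraNneq ach => ->.
move=> nhit; set full := unzip1 _.
have fullP c : c \in full -> exists2 e, mark_ok (a.1 :: unzip1 ch) e &
    [/\ e.1 = c, e.2 & c \in a.1 :: unzip1 ch].
  rewrite /full; case: ifP => a2.
    rewrite /= inE => /orP[/eqP->|].
      by exists a; [apply: mark_ok_cons|rewrite inE eqxx].
    case/mapP=> e; rewrite mem_filter => /andP[ea ech ->].
    exists (mark a.1 e); last by rewrite /= ea orbT inE (map_f fst ech) orbT.
    apply: mark_ok_mark (allP chm _ ech).
    by apply: contraNneq ach => <-; apply: map_f.
  case/mapP=> e; rewrite mem_filter => /andP[ea ech ->].
  exists (mark a.1 e); last by rewrite /= ea orbT inE (map_f fst ech) orbT.
  apply: mark_ok_mark (allP chm _ ech).
  by apply: contraNneq ach => <-; apply: map_f.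
have aP' : all P (a.1 :: unzip1 ch) by rewrite /= aP.
do 2!eexists; split; first by reflexivity.
- by rewrite /= unzip1_mark.
- rewrite /= unzip1_mark; apply/andP; split.
    exact: mark_ok_cons.
  rewrite all_map; apply/allP => e ech /=; apply: mark_ok_mark (allP chm _ ech).
  by apply: contraNneq ach => <-; apply: map_f.
move=> p pP; rewrite /= unzip1_mark inE negb_or => /andP[pa pch].
have [b bcs /andP[/eqP bp bm]] := compl p pP pch.
exists (mark a.1 b); last by rewrite /= bp eqxx mark_ok_mark // bp.
apply: map_f; rewrite mem_filter bcs andbT /keep bp.
have nshare z : covers a.1 z -> covers p z -> False.
  by move=> az pz; case/eqP: pa; apply: (conf_disjoint conf pP aP pz az).
apply/and5P; split.
- by apply/negP => /nshare; apply; rewrite coversE eqxx.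
- by apply/negP => /nshare; apply; rewrite coversE eqxx orbT.
- exact: (conf_meets conf).
- apply/hasP => -[c /fullP[e em [<- e2 ein]] /= ep].
  apply: (mark_ok_conflict aP' em e2 (allP aP' _ ein) pP _ _ ep).
    by apply: contraNneq pch => pe; move: ein; rewrite -pe inE (negPf pa).
  by rewrite inE (negPf pa).
- apply/negP => /andP[b2 pain].
  rewrite -bp in pP pa pain.
  by apply: (mark_ok_conflict chP bm b2 pP aP); rewrite // eq_sym.
Qed.

Lemma overfull_sound ch xs :
  all P (unzip1 ch) -> uniq xs -> all free xs -> ~~ overfull ch xs.
Proof.
move=> chP xu xf; rewrite /overfull !negb_or -!leqNgt.
apply/and3P; split; [exact: (conf_size conf)|exact: (conf_column conf)|].
apply/hasPn => c cch; rewrite -leqNgt; apply: (conf_cross conf) => //.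
by apply: (allP chP); apply: map_f.
Qed.

(** Follow the branch dictated by [P]: the branching cell is either free or covered by a couple of
    [P], which is still a candidate. By induction that branch is not refuted. Nothing about
    [best_cell] enters, since [refute] itself tests that the cell is open. *)
Lemma refute_sound fuel open ch cs xs :
  all P (unzip1 ch) -> all (mark_ok (unzip1 ch)) ch -> complete_for P ch cs ->
  uniq xs -> all free xs ->
  {in open, forall z, [&& z \in cells, z \notin xs
                        & ~~ has (covers^~ z) (unzip1 ch)]} ->
  refute fuel open ch cs xs = false.
Proof.
elim: fuel open ch cs xs => //= n IH open ch cs xs chP chm compl xu xf openP.
rewrite (negPf (overfull_sound chP xu xf)); set z := best_cell _ _.
case: ifP => // zopen; have /and3P[zc zx zch] := openP z zopen.
have [zf|[p pP pz]] := conf_cell conf zc.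
  rewrite IH //=.
  - move=> p pP pch; have [b bcs /andP[/eqP bp bm]] := compl p pP pch.
    exists b; last by rewrite bp eqxx.
    by rewrite mem_filter bcs bp andbT; apply: (conf_free conf).
  - by rewrite zx.
  - by rewrite zf.
  move=> y; rewrite mem_filter eqcE inE negb_or eq_sym => /andP[-> yo].
  exact: openP.
case: ifP => // _; apply/allPn.
have pch : p \notin unzip1 ch by apply: contra zch => ?; apply/hasP; exists p.
have [b bcs /andP[/eqP bp bm]] := compl p pP pch.
exists b; rewrite // bp pz; subst p.
have [ch' [cs' [-> ch'E ch'm compl']]] := extend_sound chP chm compl pP pch bm.
by rewrite IH // ?ch'E /= ?pP // => y; rewrite mem_filter negb_or => /andP[-> /openP].
Qed.

End Soundness.

(** * Couples of a complete colouring *)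

Notation board := ('I_6 * 'I_8)%type.

Definition attacks (x y : board) : bool := (x.1 == y.1) (+) (x.2 == y.2).

(** The search computes with plain numbers, colourings live on ordinals. [inord] sends an index out
    of range to 0, so this is injective only on [cells]. *)
Definition square (z : cell) : board := (inord z.1, inord z.2).
Definition coords (x : board) : cell := (val x.1, val x.2).

Lemma coordsK : cancel coords square.
Proof. by case=> a b; rewrite /square /= !inord_val. Qed.

Lemma squareK : {in cells, cancel square coords}.
Proof. by case=> a b; rewrite mem_cells => /andP[? ?]; rewrite /coords /= !inordK. Qed.

Lemma coords_cells x : coords x \in cells.
Proof. by rewrite mem_cells /= !ltn_ord. Qed.

Lemma eq_inord n a b : a <= n -> b <= n ->
  (inord a == inord b :> 'I_n.+1) = (a == b).
Proof. by move=> an bn; rewrite -val_eqE /= !inordK. Qed.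

Lemma eq_square y z : y \in cells -> z \in cells ->
  ((square y).1 == (square z).1 = (y.1 == z.1)) *
  ((square y).2 == (square z).2 = (y.2 == z.2)).
Proof.
by rewrite !mem_cells => /andP[? ?] /andP[? ?]; split; apply: eq_inord.
Qed.

Lemma square_inj : {in cells &, injective square}.
Proof.
move=> y z yc zc yz; have : (y.1 == z.1) && (y.2 == z.2).
  by rewrite -!(eq_square yc zc) yz !eqxx.
by case: y z {yc zc yz} => [a b] [c d] /= /andP[/eqP-> /eqP->].
Qed.

Definition cross2 (a b y : board) : bool :=
  [|| y.1 == a.1, y.1 == b.1, y.2 == a.2 | y.2 == b.2].

Lemma cross_square p z : p.1 \in cells -> p.2 \in cells -> z \in cells ->
  cross p z = cross2 (square p.1) (square p.2) (square z).
Proof. by move=> p1 p2 zc; rewrite /cross2 !(eq_square zc). Qed.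

Definition neighbours (a b : board) : {set board} :=
  [set y | cross2 a b y] :\: [set a; b].

Lemma cardsC2 (T : finType) (x y : T) : x != y -> #|~: [set x; y]| = #|T| - 2.
Proof. by move=> xy; rewrite cardsCs setCK cards2 xy. Qed.

(** Outside the cross lies a 4 by 6 rectangle, so the cross has 48 - 24 cells, two of which are [a]
    and [b]. *)
Lemma card_neighbours a b : a.1 != b.1 -> a.2 != b.2 -> #|neighbours a b| = 22.
Proof.
move=> ab1 ab2; have ab : a != b by apply: contraNneq ab1 => ->.
rewrite cardsD (setIidPr _) ?cards2 ?ab; last first.
  by apply/subsetP=> y; rewrite !inE => /orP[] /eqP->; rewrite /cross2 eqxx ?orbT.
rewrite cardsCs (_ : ~: _ = setX (~: [set a.1; b.1]) (~: [set a.2; b.2])).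
  by rewrite cardsX !cardsC2 // card_prod !card_ord.
by apply/setP=> y; rewrite !inE /cross2 -!negb_or -!orbA.
Qed.

Lemma card_row r : #|[set x : board | x.1 == r]| = 8.
Proof.
rewrite (_ : [set x | _] = setX [set r] setT) ?cardsX ?cardsT ?cards1 ?card_ord //.
by apply/setP=> x; rewrite !inE andbT.
Qed.

Lemma card_column c : #|[set x : board | x.2 == c]| = 6.
Proof.
rewrite (_ : [set x | _] = setX setT [set c]) ?cardsX ?cardsT ?cards1 ?card_ord //.
by apply/setP=> x; rewrite !inE.
Qed.

Record good (k : nat) (D : {set 'I_k}) (g : board -> 'I_k) : Prop := Good {
  good_range : 22 <= k;
  good_card : #|D| = 18;
  good_proper : forall x y, attacks x y -> g x != g y;
  good_complete : forall i j, i != j -> exists x y, [/\ attacks x y, g x = i & g y = j];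
  good_two : forall i, i \in D -> #|[set x | g x == i]| = 2 }.

Section GoodColouring.

Variables (k : nat) (D : {set 'I_k}) (g : board -> 'I_k).
Hypothesis gD : good D g.

Definition chosen (p : couple) : bool :=
  [&& p \in couples, g (square p.1) == g (square p.2) & g (square p.1) \in D].

Definition free (z : cell) : bool := (z \in cells) && (g (square z) \notin D).

Lemma same_colour x y : g x = g y -> x != y -> (x.1 != y.1) && (x.2 != y.2).
Proof.
move=> gxy; apply: contraNT; rewrite negb_and !negbK => xy.
have : ~~ attacks x y by apply/negP => /(good_proper gD); rewrite gxy eqxx.
case: x y {gxy} xy => [a b] [c d]; rewrite /attacks /= xpair_eqE.
by case: (a == c); case: (b == d).
Qed.

Lemma class_pair x y : x != y -> g x = g y -> g x \in D ->
  [set w | g w == g x] = [set x; y].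
Proof.
move=> xy gxy gxD; apply/esym/eqP; rewrite eqEcard (good_two gD gxD) cards2 xy.
rewrite leqnn andbT.
by apply/subsetP=> w; rewrite !inE => /orP[] /eqP->; rewrite // gxy.
Qed.

(** An edge showing the colours [g x] and [j] must start at [x] or [y], the only cells of colour
    [g x]; its other end lies in their cross. *)
Lemma neighbours_onto x y j : x != y -> g x = g y -> g x \in D -> j != g x ->
  exists2 w, w \in neighbours x y & g w = j.
Proof.
move=> xy gxy gxD jx; rewrite eq_sym in jx.
have [u [v [uv gu gv]]] := good_complete gD jx.
exists v => //; rewrite !inE.
have -> /= : ~~ ((v == x) || (v == y)).
  by apply: contraNN jx => /orP[] /eqP E; rewrite -gv E // gxy.
have : u \in [set w | g w == g x] by rewrite inE gu.
rewrite (class_pair xy gxy gxD) !inE /cross2 !(eq_sym v.1) !(eq_sym v.2).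
by move: uv; rewrite /attacks => + /orP[] /eqP<-; case: (_ == _); case: (_ == _);
  rewrite ?orbT.
Qed.

Lemma chosenP p : chosen p ->
  [/\ p.1 \in cells, p.2 \in cells, square p.1 != square p.2,
      g (square p.1) = g (square p.2) & g (square p.1) \in D].
Proof.
case/and3P; rewrite mem_couples => /and4P[p1 p2 p12 _] /eqP gp gD'; split=> //.
apply/eqP => /(square_inj p1 p2) E; by rewrite E ltnn in p12.
Qed.

Lemma chosen_covers p z : chosen p -> covers p z ->
  z \in cells /\ g (square z) = g (square p.1).
Proof.
by move=> /chosenP[p1 p2 _ gp _]; rewrite coversE => /orP[] /eqP->.
Qed.

(** Both couples enumerate the same two-element colour class, and listing the smaller row first
    rules out the swapped order. *)
Lemma chosen_inj p q : chosen p -> chosen q ->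
  g (square p.1) = g (square q.1) -> p = q.
Proof.
move=> pP qP gpq.
have [p1 p2 pn gp pD] := chosenP pP; have [q1 q2 qn gq qD] := chosenP qP.
have := class_pair pn gp pD; rewrite {1}gpq (class_pair qn gq qD) => E.
have cov z : z \in cells -> square z \in [set square q.1; square q.2] -> covers p z.
  move=> zc; rewrite E !inE coversE.
  by case/orP=> /eqP; [move/(square_inj zc p1)->|move/(square_inj zc p2)->];
    rewrite eqxx ?orbT.
have := cov _ q1; rewrite !inE eqxx => /(_ isT); rewrite coversE.
have := cov _ q2; rewrite !inE eqxx orbT => /(_ isT); rewrite coversE.
case/and3P: pP; rewrite mem_couples => /and4P[_ _ p12 _] _ _.
case/and3P: qP; rewrite mem_couples => /and4P[_ _ q12 _] _ _.
case: p q p12 q12 {p1 p2 pn gp pD q1 q2 qn gq qD gpq E cov} => [a b] [c d] /= ab cd.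
move=> /orP[] /eqP dE /orP[] /eqP cE; rewrite cE dE // in cd *.
- by rewrite ltnn in cd.
- by move: (ltn_trans ab cd); rewrite ltnn.
- by rewrite ltnn in cd.
Qed.

(** The colour of [q] must occur among the neighbours of [p], and only the two cells of [q] carry
    it. *)
Lemma chosen_meets p q : chosen p -> chosen q -> meets p q.
Proof.
move=> pP qP; have [<-|pq] := eqVneq p q.
  by rewrite /meets /cross !eqnE eqxx.
have [p1 p2 pn gp pD] := chosenP pP; have [q1 q2 qn gq qD] := chosenP qP.
have gqp : g (square q.1) != g (square p.1).
  by apply: contraNneq pq => E; apply/eqP/chosen_inj.
have [w] := neighbours_onto pn gp pD gqp.
rewrite !inE => /andP[_ wc] gw.
have : w \in [set w | g w == g (square q.1)] by rewrite inE gw.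
rewrite (class_pair qn gq qD) !inE /meets !cross_square //.
by case/orP=> /eqP <-; rewrite wc ?orbT.
Qed.

Lemma inside_neighbours p q : chosen p -> chosen q -> p != q -> inside p q ->
  (square q.1 \in neighbours (square p.1) (square p.2)) &&
  (square q.2 \in neighbours (square p.1) (square p.2)).
Proof.
move=> pP qP pq; have gqp : g (square q.1) != g (square p.1).
  by apply: contraNneq pq => E; apply/eqP/chosen_inj.
have [p1 p2 pn gp pD] := chosenP pP; have [q1 q2 qn gq qD] := chosenP qP.
rewrite /inside !cross_square // => /andP[c1 c2].
rewrite !inE c1 c2 !andbT.
apply/andP; split; apply: contraNN gqp => /orP[] /eqP E.
- by rewrite E.
- by rewrite E gp.
- by rewrite gq E.
- by rewrite gq E gp.
Qed.

Lemma card_chosen_neighbours p : chosen p ->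
  #|neighbours (square p.1) (square p.2)| = 22.
Proof.
case/chosenP=> _ _ pn gp _; have /andP[? ?] := same_colour gp pn.
exact: card_neighbours.
Qed.

(** With both couples inside the cross of [p], two of its 22 neighbours repeat colours seen on
    others. The neighbours then show at most 20 colours, fewer than the required k - 1. *)
Lemma chosen_inside p q r : chosen p -> chosen q -> chosen r ->
  uniq [:: p; q; r] -> inside p q -> inside p r -> False.
Proof.
move=> pP qP rP /and3P[]; rewrite !inE negb_or => /andP[pq pr] qr _ iq ir.
have /andP[nq1 nq2] := inside_neighbours pP qP pq iq.
have /andP[nr1 nr2] := inside_neighbours pP rP pr ir.
have [p1 p2 pn gp pD] := chosenP pP.
have [_ _ qn gq _] := chosenP qP; have [_ _ rn gr _] := chosenP rP.
have gqr : g (square q.1) != g (square r.1).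
  by apply: contraNneq qr => E; apply/eqP/chosen_inj.
set N := neighbours _ _ in nq1 nq2 nr1 nr2.
(* The deleted cells are replaced by their mates [q.2] and [r.2]. *)
have sub : ~: [set g (square p.1)] \subset g @: (N :\ square q.1 :\ square r.1).
  apply/subsetP=> j; rewrite !inE => jp.
  have [w wN gw] := neighbours_onto pn gp pD jp.
  have [wq|wq] := eqVneq w (square q.1).
    apply/imsetP; exists (square q.2); last by rewrite -gw wq.
    rewrite !in_setD1 nq2 andbT (eq_sym _ (square q.1)) qn andbT.
    by apply: contraNneq gqr => E; rewrite gq E.
  have [wr|wr] := eqVneq w (square r.1).
    apply/imsetP; exists (square r.2); last by rewrite -gw wr.
    rewrite !in_setD1 nr2 andbT (eq_sym _ (square r.1)) rn /=.
    by apply: contraNneq gqr => E; rewrite gr E.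
  by apply/imsetP; exists w; rewrite // !in_setD1 wq wr.
have := leq_trans (subset_leq_card sub) (leq_imset_card _ _).
have cN := card_chosen_neighbours pP; rewrite -/N in cN.
rewrite cardsCs setCK cards1 card_ord.
rewrite (cardsD1 (square q.1)) nq1 in cN.
rewrite (cardsD1 (square r.1)) in cN.
have rin : square r.1 \in N :\ square q.1.
  by rewrite in_setD1 nr1 andbT; apply: contraNneq gqr => ->.
move: cN; rewrite rin !add1n => -[->].
by move: (good_range gD); clear; lia.
Qed.

Definition squares (xs : seq cell) : {set board} := [set x in map square xs].

Lemma card_squares xs : uniq xs -> all free xs -> #|squares xs| = size xs.
Proof.
move=> xu xf; rewrite cardsE (card_uniqP _) ?size_map // map_inj_in_uniq //.
move=> y z /(allP xf)/andP[yc _] /(allP xf)/andP[zc _]; exact: square_inj.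
Qed.

Lemma squaresP xs x : reflect (exists2 z, z \in xs & x = square z) (x \in squares xs).
Proof. by rewrite inE; apply: mapP. Qed.

Lemma squares_free xs x : all free xs -> x \in squares xs -> g x \notin D.
Proof. by move=> xf /squaresP[z /(allP xf) /andP[_ ?] ->]. Qed.

(** The 17 other colours of [D] must appear on the neighbours of [p] that are not free, which leaves
    22 - 17 for free cells. *)
Lemma free_cross p xs : chosen p -> uniq xs -> all free xs ->
  count (cross p) xs <= 5.
Proof.
move=> pP xu xf; have [p1 p2 pn gp pD] := chosenP pP.
have xu' := filter_uniq (cross p) xu.
have xf' : all free (filter (cross p) xs).
  by apply/allP=> z; rewrite mem_filter => /andP[_ /(allP xf)].
rewrite -size_filter -(card_squares xu' xf').
set X := squares _; set N := neighbours (square p.1) (square p.2).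
have XN : X \subset N.
  apply/subsetP=> x xX; have /= xD := squares_free xf' xX.
  case/squaresP: xX => z; rewrite mem_filter => /andP[pz zx] xz.
  have /andP[zc _] := allP xf z zx.
  rewrite !inE xz -cross_square // -xz pz andbT.
  by apply: contraNN xD => /orP[] /eqP->; rewrite -?gp.
have sub : D :\ g (square p.1) \subset g @: (N :\: X).
  apply/subsetP=> j; rewrite !inE => /andP[jp jD].
  have [w wN gw] := neighbours_onto pn gp pD jp.
  apply/imsetP; exists w; rewrite // inE wN andbT.
  by apply: contraL jD => /(squares_free xf'); rewrite gw.
have := leq_trans (subset_leq_card sub) (leq_imset_card _ _).
rewrite (cardsD N) (setIidPr XN) (card_chosen_neighbours pP).
have := good_card gD; rewrite (cardsD1 (g (square p.1))) pD add1n => -[->].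
have := subset_leq_card XN; rewrite (card_chosen_neighbours pP).
by clear; lia.
Qed.

Lemma card_D_squares : #|[set x | g x \in D]| = 36.
Proof.
rewrite -sum1dep_card (partition_big g (mem D)) //=.
rewrite (eq_bigr (fun=> 2)) => [|i iD].
  by rewrite sum_nat_const (good_card gD).
apply: etrans (good_two gD iD); rewrite -sum1dep_card; apply: eq_bigl => x.
by case: eqP => [->|]; rewrite ?iD ?andbF.
Qed.

Lemma good_le23 : k <= 23.
Proof.
have /card_gt0P[i iD] : 0 < #|D| by rewrite (good_card gD).
have := good_two gD iD => /eqP/cards2P[x [y [xy cE]]].
have /eqP gx : g x == i by have := set21 x y; rewrite -cE inE.
have /eqP gy : g y == i by have := set22 x y; rewrite -cE inE.
have gxy : g x = g y by rewrite gx gy.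
have sub : ~: [set g x] \subset g @: neighbours x y.
  apply/subsetP=> j; rewrite !inE => jx.
  have [|w wN <-] := neighbours_onto xy gxy _ jx; first by rewrite gx.
  exact: imset_f.
have /andP[xy1 xy2] := same_colour gxy xy.
have := leq_trans (subset_leq_card sub) (leq_imset_card _ _).
rewrite card_neighbours // cardsCs setCK cards1 card_ord; clear; lia.
Qed.

Lemma free_size xs : uniq xs -> all free xs -> size xs <= 12.
Proof.
move=> xu xf; rewrite -(card_squares xu xf).
have sub : squares xs \subset ~: [set x | g x \in D].
  by apply/subsetP=> x /(squares_free xf); rewrite !inE.
have := subset_leq_card sub.
by rewrite [X in _ <= X]cardsCs setCK card_D_squares card_prod !card_ord.
Qed.

Lemma free_column c xs : uniq xs -> all free xs ->
  count (fun y => eqn y.2 c) xs <= 5.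
Proof.
move=> xu xf; have xu' := filter_uniq (fun y : cell => eqn y.2 c) xu.
have xf' : all free (filter (fun y => eqn y.2 c) xs).
  by apply/allP=> z; rewrite mem_filter => /andP[_ /(allP xf)].
rewrite -size_filter -(card_squares xu' xf'); set X := squares _.
(* Two cells of one column never share a colour, so these free cells use distinct colours outside
   [D]. *)
have ginj : {in X &, injective g}.
  move=> x y xX yX gxy; apply/eqP/negPn/negP => /(same_colour gxy)/andP[_].
  case/squaresP: xX => z; rewrite mem_filter eqnE => /andP[/eqP zc _] ->.
  case/squaresP: yX => w; rewrite mem_filter eqnE => /andP[/eqP wc _] ->.
  by rewrite /= zc wc eqxx.
rewrite -(card_in_imset ginj).
have sub : g @: X \subset ~: D.
  by apply/subsetP=> j /imsetP[x /(squares_free xf') xD ->]; rewrite inE.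
have := subset_leq_card sub; rewrite [X in _ <= X]cardsCs setCK card_ord (good_card gD).
by move/leq_trans; apply; rewrite leq_subLR good_le23.
Qed.

Definition couple_of (y z : cell) : couple := if y.1 < z.1 then (y, z) else (z, y).

Lemma chosen_couple_of y z : y \in cells -> z \in cells -> y != z ->
  g (square y) = g (square z) -> g (square y) \in D -> chosen (couple_of y z).
Proof.
move=> yc zc yz gyz yD.
have : square y != square z by apply: contraNneq yz => /(square_inj yc zc)->.
move/(same_colour gyz)=> /andP[]; rewrite !(eq_square yc zc) => r c.
rewrite /chosen mem_couples /couple_of; case: ltngtP (r) => //= yz1 _.
  by rewrite yc zc yz1 c gyz eqxx -gyz.
by rewrite yc zc yz1 eq_sym c gyz eqxx -gyz.
Qed.

Lemma covers_couple_of y z w : covers (couple_of y z) w = (w == y) || (w == z).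
Proof. by rewrite coversE /couple_of; case: ifP => //= _; rewrite orbC. Qed.

Lemma chosen_mate y : y \in cells -> g (square y) \in D ->
  exists z, [/\ z \in cells, y != z, chosen (couple_of y z)
               & g (square y) = g (square z)].
Proof.
move=> yc yD; have := good_two gD yD; rewrite (cardsD1 (square y)) inE eqxx.
move=> [/eqP/cards1P[x xE]]; have : x \in [set x] by rewrite inE.
rewrite -xE !inE => /andP[xy /eqP gxy]; exists (coords x).
have yx : y != coords x by apply: contraNneq xy => ->; rewrite coordsK.
split=> //; rewrite ?coords_cells ?coordsK //.
by apply: chosen_couple_of; rewrite ?coords_cells ?coordsK.
Qed.

Lemma good_configuration : configuration chosen free.
Proof.
split.
- move=> p q z pP qP /(chosen_covers pP)[_ zp] /(chosen_covers qP)[_ zq].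
  by apply: chosen_inj; rewrite // -zp.
- exact: chosen_meets.
- exact: chosen_inside.
- exact: free_cross.
- exact: free_size.
- exact: free_column.
- move=> z zc; have [zD|zD] := boolP (g (square z) \in D).
    have [w [_ _ pP _]] := chosen_mate zc zD; right.
    by exists (couple_of z w); rewrite ?covers_couple_of ?eqxx.
  by left; rewrite /free zc.
- move=> p z pP /andP[_ zD]; apply: contraNN zD => /(chosen_covers pP)[_ ->].
  by have [] := chosenP pP.
Qed.

End GoodColouring.

(** * Permuting rows and columns *)

Section Relabel.

Variables (k : nat) (D : {set 'I_k}).

Definition relabel (u : {perm 'I_6}) (v : {perm 'I_8}) (g : board -> 'I_k) x :=
  g (u x.1, v x.2).

Lemma good_relabel u v g : good D g -> good D (relabel u v g).
Proof.
case=> kk Dc gp gc g2; pose h (x : board) : board := (u x.1, v x.2).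
pose h' (x : board) : board := ((u^-1)%g x.1, (v^-1)%g x.2).
have hK : cancel h' h by case=> a b; rewrite /h /= !permKV.
have h'K : cancel h h' by case=> a b; rewrite /h' /= !permK.
have hatt x y : attacks (h x) (h y) = attacks x y.
  by rewrite /attacks /= !(inj_eq perm_inj).
split=> // [x y xy | i j /gc[x [y [xy gx gy]]] | i iD].
- by apply: gp; rewrite hatt.
- exists (h' x), (h' y); split; first by rewrite -hatt !hK.
    by rewrite /relabel -[(_, _)]/(h (h' x)) hK.
  by rewrite /relabel -[(_, _)]/(h (h' y)) hK.
apply: etrans (g2 i iD); rewrite -(card_imset _ (can_inj h'K)).
congr #|pred_of_set _|.
apply/setP=> x; rewrite inE; apply/imsetP/idP => [[y + ->]|gx].
  by rewrite inE.
by exists (h' x); rewrite ?hK // inE /relabel -[(_, _)]/(h (h' x)) hK.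
Qed.

Lemma good_column g : good D g -> exists2 g', good D g' &
  forall j, j < 5 -> g' (square (j, 0)) \in D.
Proof.
move=> gD; pose S c := [set x : board | (g x \in D) && (x.2 == c)].
(* Otherwise the eight columns would hold at most 32 of the 36 cells coloured in [D]. *)
have [c cS] : exists c, 4 < #|S c|.
  apply/existsP; apply: contraT; rewrite negb_exists => /forallP S4.
  have := card_D_squares gD.
  rewrite -sum1dep_card (partition_big (@snd _ _) predT) //= => E.
  have : \sum_(c < 8) #|S c| <= \sum_(c < 8) 4.
    by apply: leq_sum => c _; rewrite leqNgt.
  rewrite sum_nat_const card_ord; under eq_bigr do rewrite -sum1dep_card.
  by rewrite E.
(* At most one of the six cells of column [c] has a colour outside [D]; its row, or any row if there
   is none, will be moved to row 5. *)
have [r rP] : exists r, forall r', r' != r -> g (r', c) \in D.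
  pose C := [set x : board | x.2 == c].
  have SC : S c \subset C by apply/subsetP=> x; rewrite !inE => /andP[].
  have : #|C :\: S c| <= 1 by rewrite cardsD (setIidPr SC) card_column; lia.
  move/card_le1_eqP => C1.
  have [E|[[r c'] xC]] := set_0Vmem (C :\: S c).
    exists ord0 => r' _; have : (r', c) \notin C :\: S c by rewrite E inE.
    by rewrite !inE eqxx !andbT negbK.
  exists r => r'; apply: contraNT => rD.
  have c'c : c' = c by move: xC; rewrite !inE => /andP[_ /eqP].
  rewrite c'c in xC; have : (r', c) \in C :\: S c by rewrite !inE eqxx !andbT.
  by move/C1/(_ xC) => [->].
exists (relabel (tperm r ord_max) (tperm c ord0) g); first exact: good_relabel.
move=> j j5; rewrite /relabel /= (_ : inord 0 = ord0); last first.
  by apply: val_inj; rewrite /= inordK.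
rewrite tpermR; apply: rP; rewrite -{2}(tpermR r ord_max) (inj_eq perm_inj).
by rewrite -val_eqE /= inordK; lia.
Qed.

Lemma mate_couple_of y z : y != z -> mate (couple_of y z) y = z.
Proof.
move=> yz; rewrite /mate /couple_of eqcE; case: (y.1 < z.1) => /=.
  by rewrite eqxx.
by rewrite (negPf yz).
Qed.

(* No cell of a settled couple is moved when rows in [rr, 5) or columns from cc
   on are permuted. *)
Definition settled (i rr cc : nat) (p : couple) : Prop :=
  forall z, covers p z ->
  [&& (z.1 < rr) || (z.1 == 5), z.2 < cc & (z.2 == 0) ==> (z.1 < i)].

(* The candidates are complete for every good colouring that contains [ch], so
   that this survives the relabellings performed along the way. *)
Lemma refute_column_sound n i rr cc ch cs g :
  i + n = 5 -> 0 < cc -> {in unzip1 ch, forall p, settled i rr cc p} ->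
  all (mark_ok (unzip1 ch)) ch ->
  (forall h, good D h -> all (chosen D h) (unzip1 ch) ->
     complete_for (chosen D h) ch cs) ->
  good D g -> all (chosen D g) (unzip1 ch) ->
  (forall j, j < 5 -> g (square (j, 0)) \in D) ->
  refute_column n i rr cc ch cs = false.
Proof.
elim: n i rr cc ch cs g => [|n IH] i rr cc ch cs g; rewrite ?addn0.
  move=> _ _ _ chm compl gD chP _; rewrite /refute_column.
  apply: (refute_sound (good_configuration gD)) => //; first exact: compl.
  by move=> z; rewrite mem_filter has_map => /andP[-> ->].
rewrite /refute_column -/refute_column => in5 cc0 chs chm compl gD chP g0.
set rr' := maxn rr i.+1; pose z : cell := (i, 0).
have i5 : i < 5 by lia.
have zc : z \in cells by rewrite mem_cells /=; lia.
have [w [wc zw _ gzw]] := chosen_mate gD zc (g0 i i5).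
have sqzw : square z != square w.
  by apply: contraNneq zw => /(square_inj zc wc)->.
have := same_colour gD gzw sqzw; rewrite !(eq_square zc wc) /= => /andP[iw w0].
have := wc; rewrite mem_cells => /andP[w6 w8].
(* If the mate [w] lies in an untouched row or column other than the first such one, exchange the
   two; otherwise the transposition is trivial. *)
pose r := if (w.1 <= rr') || (w.1 == 5) then w.1 else rr'.
pose c := if w.2 <= cc then w.2 else cc.
pose g' := relabel (tperm (inord w.1) (inord r)) (tperm (inord w.2) (inord c)) g.
have g'D : good D g' by apply: good_relabel.
have rr'i : i < rr' by rewrite /rr'; lia.
have rP : r = w.1 \/ r = rr' /\ rr' < w.1 < 5.
  rewrite /r; case: ifPn => [_|nle]; [by left|right; split=> //].
  by move: nle w6; clear; lia.
have cP : c = w.2 \/ c = cc /\ cc < w.2.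
  by rewrite /c; case: leqP; [left|right].
have fixr a : (a < rr') || (a == 5) ->
    tperm (inord w.1) (inord r) (inord a : 'I_6) = inord a.
  case: rP => [->|[-> rw] ha]; first by rewrite tperm1 perm1.
  by apply: tpermD; rewrite eq_inord; move: ha rw; clear; lia.
have fixc a : a < cc -> tperm (inord w.2) (inord c) (inord a : 'I_8) = inord a.
  case: cP => [->|[-> cw] ha]; first by rewrite tperm1 perm1.
  by apply: tpermD; rewrite eq_inord; move: ha cw w8; clear; lia.
have g'E y : (y.1 < rr') || (y.1 == 5) -> y.2 < cc -> g' (square y) = g (square y).
  by move=> y1 y2; rewrite /g' /relabel /= fixr // fixc.
have g'z : g' (square z) = g (square z) by apply: g'E; rewrite //= rr'i.
pose w' : cell := (r, c).
have g'w : g' (square w') = g (square w) by rewrite /g' /relabel /= !tpermR.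
have chP' : all (chosen D g') (unzip1 ch).
  apply/allP=> p pch; have := allP chP p pch; rewrite /chosen.
  have sE y : covers p y -> g' (square y) = g (square y).
    move/(chs p pch)=> /and3P[y1 y2 _]; apply: g'E => //.
    by move: y1; rewrite /rr'; clear; lia.
  by rewrite !sE // coversE eqxx ?orbT.
(* Column 0 is fixed and any exchanged rows are both below 5, so its first five cells keep colours
   in [D]. *)
have g'0 j : j < 5 -> g' (square (j, 0)) \in D.
  move=> j5; rewrite /g' /relabel /= fixc //.
  case: rP => [->|[-> /andP[rw w5]]]; first by rewrite tperm1 perm1; apply: (g0 j).
  have rr5 := ltn_trans rw w5.
  by case: tpermP => [_|_|_ _]; [apply: (g0 rr')|apply: (g0 w.1)|apply: (g0 j)].
have w'c : w' \in cells.
  by rewrite mem_cells /=; move: rP cP w6 w8; clear; lia.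
have w'0 : w'.2 != 0.
  by rewrite /=; case: cP => [->|[-> _]]; rewrite -?lt0n // lt0n eq_sym.
have zw' : z != w' by apply: contraNneq w'0 => <-.
pose p := couple_of z w'.
have pP : chosen D g' p.
  by apply: chosen_couple_of; rewrite // ?g'z ?g'w //; apply: g0.
have pz : covers p z by rewrite covers_couple_of eqxx.
have pch : p \notin unzip1 ch.
  by apply/negP => /chs/(_ z pz) /and3P[_ _]; rewrite /= ltnn.
have [b bcs /andP[/eqP bp bm]] := compl g' g'D chP' p pP pch.
apply/allPn; exists b => //; rewrite -bp in pP pch.
have matep : mate b.1 z = w' by rewrite bp mate_couple_of.
rewrite -/z matep [in covers _ _]bp pz /=.
have -> /= : (r <= rr') || (r == 5) by rewrite /r; case: ifP; rewrite ?leqnn.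
have -> /= : c <= cc by rewrite /c; case: ifP.
have [ch' [cs' [extE ch'E ch'm _]]] :=
  extend_sound (good_configuration g'D) chP' chm (compl g' g'D chP') pP pch bm.
rewrite extE (IH _ _ _ _ _ g') //.
- by rewrite addSnnS.
- by rewrite leq_max cc0.
- rewrite ch'E => q; rewrite inE bp => /orP[/eqP->|/chs qs] y.
    rewrite covers_couple_of => /orP[] /eqP-> /=.
      by case: ifP; move: rr'i cc0; clear; lia.
    by rewrite (negPf w'0); case: ifP; clear; lia.
  by move/qs; case: ifP; rewrite /rr'; clear; lia.
- move=> h hD hP; have hP' := hP; rewrite ch'E /= in hP'; case/andP: hP' => hb hch.
  (* [extend] does not look at the colouring, so for [h] it returns the same [ch'] and [cs']. *)
  have [ch2 [cs2 [ext2 _ _ compl2]]] :=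
    extend_sound (good_configuration hD) hch chm (compl h hD hch) hb pch bm.
  by move: ext2 compl2; rewrite extE => -[<- <-].
- by rewrite ch'E /= pP.
Qed.

Lemma no_good_colouring g : ~ good D g.
Proof.
case/good_column => g' gD g0; have := column_refuted.
rewrite (refute_column_sound _ _ _ _ _ gD) // => h hD _ p pP _.
exists (p, false); last by rewrite eqxx.
by apply: (map_f (fun q => (q, false))); case/and3P: pP.
Qed.

End Relabel.

(** * The upper bound, by counting colour classes *)

Lemma subset_of_card (T : finType) (A : {set T}) n : n <= #|A| ->
  exists2 B : {set T}, B \subset A & #|B| = n.
Proof.
move=> nA; exists [set x in take n (enum A)].
  by apply/subsetP=> x; rewrite inE => /mem_take; rewrite mem_enum.
rewrite cardsE (card_uniqP _) ?take_uniq ?enum_uniq //.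
by rewrite size_takel // -cardE.
Qed.

Section UpperBound.

Variables (k : nat) (f : board -> 'I_k).
Hypothesis f_proper : forall x y, attacks x y -> f x != f y.
Hypothesis f_complete : forall i j, i != j ->
  exists x y, [/\ attacks x y, f x = i & f y = j].
Hypothesis f_onto : forall i, exists x, f x = i.

(** A colour with a single cell meets the others only in the row and column of that cell, crudely 8
    + 6 cells, so k - 1 would be at most 14. *)
Lemma two_cells_per_colour i : 16 <= k -> 1 < #|[set x | f x == i]|.
Proof.
move=> k16; rewrite ltn_neqAle eq_sym; apply/andP; split; last first.
  by have [x fx] := f_onto i; apply/card_gt0P; exists x; rewrite inE fx.
apply/negP=> /cards1P[a aE].
have sub : ~: [set i] \subset
    f @: ([set x | x.1 == a.1] :|: [set x | x.2 == a.2]).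
  apply/subsetP=> j; rewrite !inE eq_sym => /f_complete[x [y [xy fx <-]]].
  apply: imset_f; rewrite !inE.
  have : x \in [set x | f x == i] by rewrite inE fx.
  rewrite aE inE => /eqP <-; move: xy; rewrite /attacks !(eq_sym y.1) !(eq_sym y.2).
  by case: (_ == _); case: (_ == _).
have := leq_trans (subset_leq_card sub) (leq_imset_card _ _).
rewrite cardsU card_row card_column cardsCs setCK cards1 card_ord => kle.
by have := leq_trans kle (leq_subr _ _); move: k16; clear; lia.
Qed.

Lemma colours_le : k <= 21.
Proof.
rewrite leqNgt; apply/negP=> k22.
pose A := [set i | #|[set x | f x == i]| == 2].
(* A class of size s, being at least 2, satisfies 3 <= s + [s = 2]; sum over all colours. With k >=
   22 this gives [A] at least 18 elements. *)
have : 3 * k <= 48 + #|A|.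
  have -> : 48 = \sum_i #|[set x | f x == i]|.
    have : \sum_(x : board) 1 = 48 by rewrite sum1_card card_prod !card_ord.
    rewrite (partition_big f predT) //= => <-; apply: eq_bigr => i _.
    exact: sum1dep_card.
  have -> : 3 * k = \sum_(i < k) 3 by rewrite sum_nat_const card_ord mulnC.
  rewrite -sum1_card (big_mkcond (fun i => i \in A)) -big_split /=.
  apply: leq_sum => i _; rewrite inE.
  have := two_cells_per_colour i (leq_trans _ k22) => /(_ isT).
  by case: #|_| => [|[|[|m]]].
move=> kA; have [|D DA D18] := @subset_of_card _ A 18.
  by move: kA k22; case: #|A| => [|m]; clear; lia.
apply: (@no_good_colouring k D f); split=> // i /(subsetP DA).
by rewrite inE => /eqP.
Qed.

End UpperBound.

(** * A complete 21-colouring *)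

Definition colour_grid : seq (seq nat) :=
  [:: [::  6;  4; 17; 10; 14;  8; 12; 19];
      [::  2;  5; 12;  7; 16;  9; 19; 17];
      [:: 10; 20; 16;  6; 11; 13;  1;  0];
      [::  3; 14;  1;  9;  4;  7;  0; 11];
      [::  5;  2;  8; 15; 18;  0; 11;  1];
      [:: 19; 13;  3; 18; 15; 20; 17; 12]].

Definition grid_colour (z : cell) : nat := nth 0 (nth [::] colour_grid z.1) z.2.

Definition grid_edges : seq (cell * cell) :=
  [seq p <- [seq (y, z) | y <- cells, z <- cells] |
     (p.1.1 == p.2.1) (+) (p.1.2 == p.2.2)].

Definition grid_colour_pairs : seq (nat * nat) :=
  [seq (grid_colour p.1, grid_colour p.2) | p <- grid_edges].

Lemma grid_colour_lt : all (fun z => grid_colour z < 21) cells.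
Proof. by vm_compute. Qed.

Lemma grid_colour_proper : all (fun p => p.1 != p.2) grid_colour_pairs.
Proof. by vm_compute. Qed.

Lemma grid_colour_complete :
  all (fun i => all (fun j => (i == j) || ((i, j) \in grid_colour_pairs))
    (iota 0 21)) (iota 0 21).
Proof. by vm_compute. Qed.

Lemma mem_grid_edges p : (p \in grid_edges) =
  [&& (p.1.1 == p.2.1) (+) (p.1.2 == p.2.2), p.1 \in cells & p.2 \in cells].
Proof.
rewrite mem_filter; congr (_ && _).
by case: p => x y; apply/allpairsP/andP => [[[i j]] /= [xi yi [-> ->]]|[xi yi]];
  last exists (x, y).
Qed.

Definition grid_colouring : {ffun board -> 'I_21} :=
  [ffun x => inord (grid_colour (coords x))].

Lemma val_grid_colouring x : grid_colouring x = grid_colour (coords x) :> nat.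
Proof. by rewrite ffunE inordK // (allP grid_colour_lt) ?coords_cells. Qed.

Lemma complete_21_colouring :
  has_complete_colouring (cartesian_product (complete_graph 6) (complete_graph 8)) 21.
Proof.
have proper x y : attacks x y -> grid_colouring x != grid_colouring y.
  move=> xy; have pe : (coords x, coords y) \in grid_edges.
    by rewrite mem_grid_edges !coords_cells !andbT.
  rewrite -val_eqE /= !val_grid_colouring.
  exact: (allP grid_colour_proper _ (map_f _ pe)).
have hit i j : i != j -> exists x y,
    [/\ attacks x y, grid_colouring x = i & grid_colouring y = j].
  move=> ij; have mi (l : 'I_21) : (l : nat) \in iota 0 21.
    by rewrite mem_iota ltn_ord.
  have := allP (allP grid_colour_complete _ (mi i)) _ (mi j).
  rewrite val_eqE (negPf ij) => /mapP[[y z]].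
  rewrite mem_grid_edges => /and3P[yz yc zc] [iE jE].
  exists (square y), (square z); split; first by rewrite /attacks !(eq_square yc zc).
    by apply: val_inj; rewrite /= val_grid_colouring iE squareK.
  by apply: val_inj; rewrite /= val_grid_colouring jE squareK.
apply/existsP; exists grid_colouring; apply/and3P; split.
- apply/forallP=> x; apply/forallP=> y; apply/implyP.
  by rewrite adj_cartesian_complete; apply: proper.
- apply/forallP=> i; apply/forallP=> j; apply/implyP=> /hit[x [y [xy <- <-]]].
  apply/existsP; exists x; apply/existsP; exists y.
  by rewrite adj_cartesian_complete !eqxx !andbT.
(* The witness is a colour other than [i]: 1 when [i] is 0, and 0 otherwise. An edge joining the two
   colours then shows [i]. *)
- apply/forallP=> i; have : i != inord (i == 0 :> nat).
    by rewrite -val_eqE /= inordK; case: (nat_of_ord i) => [|[]].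
  by move/hit=> [x [y [_ <- _]]]; apply/existsP; exists x.
Qed.

Theorem theorem13 :
  achr (cartesian_product (complete_graph 6) (complete_graph 8)) = 21.
Proof.
apply/eqP; rewrite eqn_leq; apply/andP; split.
  apply/bigmax_leqP => k /existsP[f /and3P[fp fc fo]].
  apply: (@colours_le k f) => [x y xy|i j ij|i].
  - move/forallP/(_ x)/forallP/(_ y)/implyP: fp; apply.
    by rewrite adj_cartesian_complete.
  - have /existsP[x /existsP[y /and3P[xy /eqP fx /eqP fy]]] :=
      implyP (forallP (forallP fc i) j) ij.
    by exists x, y; split; rewrite // -?fx; move: xy; rewrite adj_cartesian_complete.
  - by have /existsP[x /eqP fx] := forallP fo i; exists x.
have lt21 : 21 < #|vertex (cartesian_product (complete_graph 6) (complete_graph 8))|.+1.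
  by rewrite card_prod !card_ord.
by apply: (@leq_bigmax_cond _ _ _ (Ordinal lt21)); apply: complete_21_colouring.
Qed.
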